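(* Let $f:\mathbb{R}^d\to\mathbb{R}$ be twice differentiable, strictly convex and strongly self-concordant with parameter $M>0$, with minimizer $x_*$. Let $0<\alpha<\beta<1$ with $\alpha<\frac12$. Let $x_0\in\mathbb{R}^d$ be any initial point, $B_0\in\mathbb{S}^d_{++}$ any initial Hessian approximation, and let $\{x_t\}_{t\ge 0}$ be generated by the BFGS method with step sizes satisfying the Armijo–Wolfe conditions with parameters $\alpha,\beta$. Then for every integer $t\ge 1$, $$\frac{f(x_t)-f(x_* )}{f(x_0)-f(x_* )}\le\left(1-\frac{\alpha(1-\beta)e^{-\Psi(\bar B_0)/t}}{(1+D_0)^2}\right)^{t}.$$ Moreover, when $t\ge\Psi(\bar B_0)$, $$\frac{f(x_t)-f(x_* )}{f(x_0)-f(x_* )}\le\left(1-\frac{\alpha(1-\beta)}{3(1+D_0)^2}\right)^{t}.$$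
   Context: $\mathbb{S}^d_{++}$ is the set of $d\times d$ symmetric positive definite matrices; $A\preceq B$ means $B-A$ is positive semidefinite. Strict convexity means $\nabla^2 f(x)\succ 0$ for all $x$. For $x,u\in\mathbb{R}^d$, $\|u\|_x:=\sqrt{u^\top\nabla^2 f(x)u}$. $f$ is strongly self-concordant with parameter $M>0$ if for all $x,y,z\in\mathbb{R}^d$, $\nabla^2 f(x)-\nabla^2 f(y)\preceq M\|x-y\|_z\nabla^2 f(y)$. $f$ is assumed to have a (unique) minimizer $x_*$. BFGS method: with $g_t=\nabla f(x_t)$, set $d_t=-B_t^{-1}g_t$, $x_{t+1}=x_t+\eta_t d_t$ with $\eta_t>0$, $s_t=x_{t+1}-x_t$, $y_t=\nabla f(x_{t+1})-\nabla f(x_t)$, and $B_{t+1}=B_t-\frac{B_ts_ts_t^\top B_t}{s_t^\top B_ts_t}+\frac{y_ty_t^\top}{s_t^\top y_t}$. It is understood that $g_t\ne 0$ along the run, so that everything is well defined. Armijo–Wolfe conditions: $f(x_t+\eta_td_t)\le f(x_t)+\alpha\eta_t\nabla f(x_t)^\top d_t$ and $\nabla f(x_t+\eta_td_t)^\top d_t\ge\beta\nabla f(x_t)^\top d_t$. $\Psi(A):=\mathrm{Tr}(A)-d-\log\det(A)$ for $A\in\mathbb{S}^d_{++}$. $\omega(x):=x-\log(1+x)$, and $\omega^{-1}:[0,\infty)\to[0,\infty)$ is the inverse of $\omega$ restricted to $[0,\infty)$. $C_t:=f(x_t)-f(x_* )$, $D_t:=2\omega^{-1}(M^2C_t/4)$.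 $\bar B_0:=\frac{1}{1+D_0}\nabla^2 f(x_* )^{-1/2}B_0\nabla^2 f(x_* )^{-1/2}$. *)

(* Defs.v *)
From HB Require Import structures.
From mathcomp Require Import all_boot all_order all_algebra.
From mathcomp Require Import all_classical all_reals all_analysis.

Set Implicit Arguments.
Unset Strict Implicit.
Unset Printing Implicit Defensive.

Import Order.TTheory GRing.Theory Num.Theory.
Import numFieldNormedType.Exports.

Local Open Scope classical_set_scope.
Local Open Scope ring_scope.

Section Definitions.
Context {R : realType} {d : nat}.

Definition dotc (u v : 'cV[R]_d) : R := (u^T *m v) 0 0.

Definition psdmx (A : 'M[R]_d) : Prop :=
  A^T = A /\ forall u : 'cV[R]_d, 0 <= dotc u (A *m u).

Definition pdmx (A : 'M[R]_d) : Prop :=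
  A^T = A /\ forall u : 'cV[R]_d, u != 0 -> 0 < dotc u (A *m u).

Definition loewner_le (A B : 'M[R]_d) : Prop := psdmx (B - A).

(* On positive definite matrices, squaring is a bijection onto the positive
   definite matrices; outside them the value is irrelevant. *)
Definition sqrtmx : 'M[R]_d -> 'M[R]_d :=
  'pinv_(fun=> 0) [set S | pdmx S] (fun S => S *m S).

Definition invsqrtmx (A : 'M[R]_d) : 'M[R]_d := sqrtmx (invmx A).

Definition gradient (f : 'cV[R]_d -> R) (x : 'cV[R]_d) : 'cV[R]_d :=
  \col_i 'D_(delta_mx i 0) f x.

Definition hessian (f : 'cV[R]_d -> R) (x : 'cV[R]_d) : 'M[R]_d :=
  \matrix_(i, j) 'D_(delta_mx j 0) (gradient f) x i 0.

Definition twice_differentiable (f : 'cV[R]_d -> R) : Prop :=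
  (forall x, differentiable f x) /\ (forall x, differentiable (gradient f) x).

Definition strictly_convex (f : 'cV[R]_d -> R) : Prop :=
  forall x, pdmx (hessian f x).

Definition local_norm (f : 'cV[R]_d -> R) (x u : 'cV[R]_d) : R :=
  Num.sqrt (dotc u (hessian f x *m u)).

Definition strongly_self_concordant (f : 'cV[R]_d -> R) (M : R) : Prop :=
  forall x y z : 'cV[R]_d,
    loewner_le (hessian f x - hessian f y)
               ((M * local_norm f z (x - y)) *: hessian f y).

Definition minimizer (f : 'cV[R]_d -> R) (xs : 'cV[R]_d) : Prop :=
  forall x, f xs <= f x.

Definition bfgs_update (B : 'M[R]_d) (s y : 'cV[R]_d) : 'M[R]_d :=
  B - (dotc s (B *m s))^-1 *: (B *m s *m s^T *m B)
    + (dotc s y)^-1 *: (y *m y^T).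

Definition bfgs_dir (f : 'cV[R]_d -> R) (x : 'cV[R]_d) (B : 'M[R]_d)
  : 'cV[R]_d := - (invmx B *m gradient f x).

Definition bfgs_run (f : 'cV[R]_d -> R) (x : nat -> 'cV[R]_d)
    (B : nat -> 'M[R]_d) (eta : nat -> R) : Prop :=
  forall t,
    [/\ gradient f (x t) != 0,
        0 < eta t,
        x t.+1 = x t + eta t *: bfgs_dir f (x t) (B t) &
        B t.+1 = bfgs_update (B t) (x t.+1 - x t)
                             (gradient f (x t.+1) - gradient f (x t))].

Definition armijo_wolfe (f : 'cV[R]_d -> R) (alpha beta : R)
    (x dir : 'cV[R]_d) (eta : R) : Prop :=
  f (x + eta *: dir) <= f x + alpha * eta * dotc (gradient f x) dir /\
  beta * dotc (gradient f x) dir <= dotc (gradient f (x + eta *: dir)) dir.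

Definition Psi (A : 'M[R]_d) : R := \tr A - d%:R - ln (\det A).

Definition omega (x : R) : R := x - ln (1 + x).

Definition omega_inv : R -> R := 'pinv_(fun=> 0) `[0, +oo[ omega.

(* [subopt f xs (x t)] is C_t and [Dval f M xs (x t)] is D_t. *)
Definition subopt (f : 'cV[R]_d -> R) (xs x : 'cV[R]_d) : R := f x - f xs.

Definition Dval (f : 'cV[R]_d -> R) (M : R) (xs x : 'cV[R]_d) : R :=
  2 * omega_inv (M ^+ 2 * subopt f xs x / 4).

Definition Bbar (f : 'cV[R]_d -> R) (M : R) (xs x0 : 'cV[R]_d)
    (B0 : 'M[R]_d) : 'M[R]_d :=
  (1 + Dval f M xs x0)^-1 *:
    (invsqrtmx (hessian f xs) *m B0 *m invsqrtmx (hessian f xs)).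

End Definitions.

(* Main.v *)
(* Write H for the Hessian at the minimizer, K = 1 + D_0, P = K H and W = P^-1.
   Strong self-concordance gives D_0 >= M |x_t - xs|_{xs}, whence H / K <= Hessian
   <= K H on all relevant segments. The upper bound makes the gradient cocoercive,
   (y, W y) <= (s, y), so the BFGS potential Psi(W B_t) satisfies
   Psi(W B_{t+1}) <= Psi(W B_t) + ln kappa_t with
   kappa_t = (g, s)^2 / ((g, W g) (s, y)). The lower bound gives the gradient
   domination f(x) - f(xs) <= K^2 (g, W g), so with the Armijo-Wolfe conditions
   C_{t+1} <= (1 - alpha (1 - beta) kappa_t / K^2) C_t. Since Psi >= 0, the sum of
   the ln kappa_t is at least - Psi(W B_0), and AM-GM concludes. *)

Require Import Defs.
From HB Require Import structures.
From mathcomp Require Import all_boot all_order all_algebra.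
From mathcomp Require Import all_classical all_reals all_analysis.
From mathcomp Require Import complex ring lra.

Set Implicit Arguments.
Unset Strict Implicit.
Unset Printing Implicit Defensive.

Import Order.TTheory GRing.Theory Num.Theory.
Import numFieldNormedType.Exports.

Local Open Scope ring_scope.

(** * Positive definite matrices *)

Section LinearAlgebra.
Context {R : realType} {d : nat}.
Implicit Types (u v w : 'cV[R]_d) (A B : 'M[R]_d).

Lemma dotcC u v : dotc u v = dotc v u.
Proof. by rewrite /dotc -[v^T *m u]trmxK trmx_mul trmxK [RHS]mxE. Qed.

Lemma dotcDr w u v : dotc w (u + v) = dotc w u + dotc w v.
Proof. by rewrite /dotc mulmxDr mxE. Qed.

Lemma dotcZr a w u : dotc w (a *: u) = a * dotc w u.
Proof. by rewrite /dotc -scalemxAr mxE. Qed.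

Lemma dotcNr w u : dotc w (- u) = - dotc w u.
Proof. by rewrite -scaleN1r dotcZr mulN1r. Qed.

Lemma dotcDl w u v : dotc (u + v) w = dotc u w + dotc v w.
Proof. by rewrite dotcC dotcDr !(dotcC w). Qed.

Lemma dotcZl a w u : dotc (a *: u) w = a * dotc u w.
Proof. by rewrite dotcC dotcZr (dotcC w). Qed.

Lemma dotcNl w u : dotc (- u) w = - dotc u w.
Proof. by rewrite dotcC dotcNr (dotcC w). Qed.

Lemma dotc0r w : dotc w 0 = 0.
Proof. by rewrite /dotc mulmx0 mxE. Qed.

Lemma dotc_mulmx u A v : dotc u (A *m v) = dotc (A^T *m u) v.
Proof. by rewrite /dotc trmx_mul trmxK mulmxA. Qed.

Lemma dotc_sym u A v : A^T = A -> dotc u (A *m v) = dotc v (A *m u).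
Proof. by move=> As; rewrite dotc_mulmx As dotcC. Qed.

Lemma dotc_gt0 u : u != 0 -> 0 < dotc u u.
Proof.
move=> u0; rewrite lt_def.
have -> : dotc u u = \sum_i u i 0 ^+ 2.
  by rewrite /dotc mxE; apply: eq_bigr => i _; rewrite mxE expr2.
rewrite sumr_ge0 ?andbT; last by move=> i _; exact: sqr_ge0.
apply: contra_neq u0 => /eqP; rewrite psumr_eq0; last by move=> i _; exact: sqr_ge0.
move=> /allP h; apply/matrixP => i j; rewrite ord1 mxE.
by apply/eqP; rewrite -sqrf_eq0; apply: (h i); rewrite mem_index_enum.
Qed.

Lemma pdmx_ge0 A u : pdmx A -> 0 <= dotc u (A *m u).
Proof.
case=> _ h; have [->|u0] := eqVneq u 0; first by rewrite mulmx0 dotc0r.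
exact/ltW/h.
Qed.

Lemma pdmx_unit A : pdmx A -> A \in unitmx.
Proof.
case=> As h; rewrite -row_free_unit -kermx_eq0; apply/rowV0P => v /sub_kermxP vA.
apply/eqP; apply: contraT => v0.
have /h : v^T != 0 by rewrite -trmx0 (inj_eq trmx_inj).
by rewrite /dotc trmxK mulmxA vA mul0mx mxE ltxx.
Qed.

Lemma pdmx_scale a A : 0 < a -> pdmx A -> pdmx (a *: A).
Proof.
move=> a0 [As h]; split=> [|u u0]; first by rewrite linearZ /= As.
by rewrite -scalemxAl dotcZr mulr_gt0 ?h.
Qed.

Lemma pdmx_congr A B : B^T = B -> B \in unitmx -> pdmx A ->
  pdmx (B *m A *m B).
Proof.
move=> Bs Bu [As h]; split=> [|u u0].
  by rewrite !trmx_mul As Bs mulmxA.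
rewrite -!mulmxA dotc_mulmx Bs; apply: h.
by apply: contra_neq u0 => /(congr1 (mulmx (invmx B))); rewrite mulKmx // mulmx0.
Qed.

Lemma invmx_sym A : A^T = A -> (invmx A)^T = invmx A.
Proof. by move=> As; rewrite trmx_inv As. Qed.

Lemma pdmx_inv A : pdmx A -> pdmx (invmx A).
Proof.
move=> Apd; have Au := pdmx_unit Apd; have [As _] := Apd.
have -> : invmx A = invmx A *m A *m invmx A by rewrite mulVmx // mul1mx.
by apply: pdmx_congr => //; rewrite ?unitmx_inv // invmx_sym.
Qed.

Lemma pdmx_sqr B : B^T = B -> B \in unitmx -> pdmx (B *m B).
Proof.
move=> Bs Bu; rewrite -[X in X *m _]mulmx1; apply: pdmx_congr => //.
by split=> [|u]; rewrite ?trmx1 // mul1mx; exact: dotc_gt0.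
Qed.

(* The unitary diagonalization exists over R[i]; since both A and its spectrum
   are real, the conjugating matrix can be taken real (not orthogonal). *)
Lemma pdmx_diagonalization A : pdmx A -> exists (P : 'M[R]_d) (l : 'rV[R]_d),
  [/\ P \in unitmx, A = invmx P *m diag_mx l *m P & forall i, 0 < l 0 i].
Proof.
move=> [As Apos]; pose toC := real_complex R.
have real_toC m n (B : 'M[R]_(m, n)) : map_mx toC B \is a mxOver Num.real.
  by apply/mxOverP => i j; rewrite mxE; apply/complex_realP; exists (B i j).
have of_real m n (B : 'M[complex R]_(m, n)) : B \is a mxOver Num.real ->
    map_mx toC (map_mx (@complex.Re R) B) = B.
  by move=> /mxOverP Br; apply/matrixP => i j; rewrite !mxE; apply: RRe_real.
have AC : map_mx toC A \is hermsymmx.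
  apply: realsym_hermsym (real_toC _ _ _).
  by apply/is_hermitianmxP; rewrite expr0 scale1r map_trmx As map_mx_id.
pose l := map_mx (@complex.Re R) (spectral_diag (map_mx toC A)).
have lE : map_mx toC l = spectral_diag (map_mx toC A).
  exact/of_real/hermitian_spectral_diag_real.
have /orthomx_spectralP Aeq := hermitian_normalmx AC.
have Pu := spectral_unit (map_mx toC A).
have sim : similar_in unitmx (map_mx toC A) (map_mx toC (diag_mx l)).
  exists (spectralmx (map_mx toC A)) => //; apply/similarP => //.
  by rewrite {2}Aeq map_diag_mx lE !mulmxA mulmxV // mul1mx.
have [Q /andP[Qr Qu] /(similarP Qu) QA] :=
  real_similar sim (real_toC _ _ _) (real_toC _ _ _).
pose P := map_mx (@complex.Re R) Q.
have PE : map_mx toC P = Q by exact: of_real.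
have PU : P \in unitmx by rewrite -(map_unitmx toC) PE.
have PA : P *m A = diag_mx l *m P.
  by apply: (@map_mx_inj _ _ toC); rewrite !map_mxM PE QA.
exists P, l; split=> //; first by rewrite -mulmxA -PA mulKmx.
(* Row [i] of [P] is a nonzero left eigenvector of [A], so positivity of the form there makes its
   eigenvalue positive. *)
move=> i; have rowE : row i P *m A = l 0 i *: row i P.
  by rewrite -row_mul PA row_mul row_diag_mx -scalemxAl -rowE.
have r0 : (row i P)^T != 0.
  rewrite -trmx0 (inj_eq trmx_inj); apply/eqP => rP0.
  have : row i (P *m invmx P) = 0 by rewrite row_mul rP0 mul0mx.
  by rewrite mulmxV // => /rowP /(_ i) /eqP; rewrite !mxE eqxx oner_eq0.
have := Apos _ r0; rewrite /dotc trmxK mulmxA rowE -scalemxAl mxE.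
by rewrite pmulr_lgt0 //; have := dotc_gt0 r0; rewrite /dotc trmxK.
Qed.

End LinearAlgebra.

(** * Auxiliary facts on logarithms, interpolation and determinants *)

Lemma ln_prod (R : realType) (I : Type) (s : seq I) (F : I -> R) :
  (forall i, 0 < F i) -> ln (\prod_(i <- s) F i) = \sum_(i <- s) ln (F i).
Proof.
move=> F0; elim: s => [|i s IH]; first by rewrite !big_nil ln1.
by rewrite !big_cons lnM ?posrE ?F0 ?prodr_gt0 // IH.
Qed.

(** Each new node is fitted by adding a multiple of the polynomial that vanishes at the others. This
    turns a function of the spectrum into a polynomial in the matrix. *)
Lemma poly_interpolation (F : fieldType) (s : seq F) (g : F -> F) :
  exists p : {poly F}, forall x, x \in s -> p.[x] = g x.
Proof.
elim: s => [|a s [p ps]]; first by exists 0.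
have [as_|as_] := boolP (a \in s).
  by exists p => x; rewrite inE => /predU1P[->|]; exact: ps.
pose q := \prod_(y <- s) ('X - y%:P).
have qa : q.[a] != 0 by rewrite -/(root q a) root_prod_XsubC.
exists (p + ((g a - p.[a]) / q.[a])%:P * q) => x; rewrite inE !hornerE.
case: eqVneq => [->|_ /= xs]; first by rewrite divfK // addrC subrK.
by rewrite ps // (rootP (_ : root q x)) ?mulr0 ?addr0 // root_prod_XsubC.
Qed.

(** Makes polynomials in a symmetric matrix symmetric, which conjugation by a possibly
    non-orthogonal matrix does not show. *)
Lemma trmx_horner_mx (F : comNzRingType) n (A : 'M[F]_n.+1) (p : {poly F}) :
  (horner_mx A p)^T = horner_mx A^T p.
Proof.
elim/poly_ind: p => [|p c IH]; first by rewrite !rmorph0 trmx0.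
rewrite !rmorphD !rmorphM /= !horner_mx_X !horner_mx_C linearD /= tr_scalar_mx.
rewrite -mulmxE trmx_mul IH; congr (_ + _).
exact/comm_mx_sym/comm_horner_mx/comm_mx_refl.
Qed.

(** Sylvester's identity: multiplying one block matrix by a unipotent one, on either side, gives a
    block triangular product with the same determinant. *)
Lemma det_addmx_mulC (F : comNzRingType) m n (U : 'M[F]_(m, n)) (V : 'M[F]_(n, m)) :
  \det (1%:M + U *m V) = \det (1%:M + V *m U).
Proof.
have h1 : block_mx 1%:M (- U) V 1%:M *m block_mx 1%:M U 0 1%:M
   = block_mx 1%:M 0 V (1%:M + V *m U).
  by rewrite mulmx_block !mul1mx !mulmx1 !mulmx0 !addr0 subrr addrC.
have h2 : block_mx 1%:M U 0 1%:M *m block_mx 1%:M (- U) V 1%:M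
   = block_mx (1%:M + U *m V) 0 V 1%:M.
  by rewrite mulmx_block !mul1mx !mulmx1 !mul0mx !add0r addNr.
have := congr1 determinant h1; have := congr1 determinant h2.
rewrite !det_mulmx !det_lblock !det_ublock !det1 !mulr1 !mul1r.
by move=> -> ->.
Qed.

(** Adding the second block column to the first creates an identity pivot, whose Schur complement is
    [- X]. *)
Lemma det_block0 (F : comNzRingType) n (X Y : 'M[F]_n) :
  \det (block_mx 0 1%:M X Y) = \det (- X).
Proof.
have : block_mx 0 1%:M X Y *m block_mx 1%:M 0 1%:M 1%:M =
    block_mx 1%:M 0 (X + Y) 1%:M *m block_mx 1%:M 1%:M 0 (- X).
  rewrite !mulmx_block !(mul0mx, mulmx0, mul1mx, mulmx1, add0r, addr0).
  by rewrite addrAC subrr add0r.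
move=> /(congr1 determinant).
by rewrite !det_mulmx !det_lblock det_ublock !det1 !(mul1r, mulr1).
Qed.

(** * Square roots, determinants and the potential of positive definite matrices *)

Section PositiveDefinite.
Context {R : realType} {d : nat}.
Implicit Types (u v w s y : 'cV[R]_d) (A B S : 'M[R]_d).

(** A fourth root [T] is built first, as a polynomial in [A] and hence symmetric. Then [T *m T] is
    positive definite, being the square of a symmetric invertible matrix. *)
Lemma pdmx_sqrt_ex A : pdmx A -> exists2 S, pdmx S & S *m S = A.
Proof.
move=> Apd; have Au := pdmx_unit Apd; have [As _] := Apd.
suff [T Ts T4] : exists2 T, T^T = T & (T *m T) *m (T *m T) = A.
  exists (T *m T) => //; apply: pdmx_sqr => //.
  by move: Au; rewrite -T4 !unitmx_mul => /andP[/andP[]].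
have [P [l [Pu PE l0]]] := pdmx_diagonalization Apd.
(* [horner_mx] is typed for dimension [n.+1], so dimension zero is treated apart. *)
case: d A Apd Au As P l Pu PE l0 => [|n] A Apd Au As P l Pu PE l0.
  by exists 0; rewrite ?trmx0 // [LHS]flatmx0 [RHS]flatmx0.
have [q ql] := poly_interpolation [seq l 0 i | i <- enum 'I_n.+1]
  (fun x => Num.sqrt (Num.sqrt x)).
exists (horner_mx A q); first by rewrite trmx_horner_mx As.
have {}ql : diag_mx (map_mx (horner q) l) ^+ 4 = diag_mx l.
  apply/matrixP => i j; rewrite -horner_mx_diag -rmorphXn /= horner_mx_diag !mxE.
  case: eqVneq => // _; rewrite !mulr1n hornerE ql ?map_f ?mem_enum //.
  by rewrite (exprM _ 2 2) !sqr_sqrtr ?sqrtr_ge0 // ltW.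
rewrite !mulmxE -!expr2 -exprM -rmorphXn /=.
have -> : A = invmx P *m diag_mx l *m invmx (invmx P) by rewrite invmxK.
rewrite mxpoly.horner_mx_uconj ?unitmxE // -?unitmxE ?unitmx_inv //.
by rewrite rmorphXn /= horner_mx_diag ql.
Qed.

(** ['pinv_] returns a preimage whenever one exists, so the existence of a root yields both
    claims. *)
Lemma sqrtmxP A : pdmx A -> pdmx (sqrtmx A) /\ sqrtmx A *m sqrtmx A = A.
Proof.
move=> /pdmx_sqrt_ex[S Spd SE].
have surj : set_surj [set S | pdmx S] [set A] (fun S => S *m S).
  by move=> _ ->; exists S.
split; last by apply: (surjpK _ surj); rewrite inE.
by apply: (surjpinv_image_sub (dflt := fun=> 0) surj); exists A.
Qed.

Lemma pdmx_det_gt0 A : pdmx A -> 0 < \det A.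
Proof.
move=> /pdmx_diagonalization[P [l [Pu -> l0]]].
rewrite !det_mulmx mulrAC det_inv mulVf -?unitfE -?unitmxE // mul1r det_diag.
exact: prodr_gt0.
Qed.

(* In terms of eigenvalues, Psi A is the sum of l - 1 - ln l. *)
Lemma Psi_ge0 A : pdmx A -> 0 <= Psi A.
Proof.
move=> /pdmx_diagonalization[P [l [Pu -> l0]]].
rewrite /Psi !det_mulmx mulrAC det_inv mulVf -?unitfE -?unitmxE // mul1r det_diag.
rewrite mxtrace_mulC mulmxA mulmxV // mul1mx mxtrace_diag ln_prod //.
have -> : d%:R = \sum_(i < d) (1 : R) by rewrite sumr_const card_ord.
rewrite -!sumrB sumr_ge0 // => i _.
have e : 1 + (l 0 i - 1) = l 0 i by ring.
by rewrite subr_ge0 -{1}e le_ln1Dx // ltrBrDl subrr.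
Qed.

End PositiveDefinite.

(** * The BFGS update *)

Section BFGS.
Context {R : realType} {d : nat}.
Implicit Types (g u v w s y : 'cV[R]_d) (A B S W : 'M[R]_d).

Lemma mulmx_trE s y : s^T *m y = (dotc s y)%:M.
Proof. exact: mx11_scalar. Qed.

(** Completing the square, the form at u is (v, B v) + (y, u)^2 / (s, y), where v is the part of u
    that is B-orthogonal to s. If v = 0, then u is a nonzero multiple of s and the second term is
    positive. *)
Lemma bfgs_update_pd B s y : pdmx B -> 0 < dotc s y -> pdmx (bfgs_update B s y).
Proof.
move=> Bpd sy; have [Bs Bp] := Bpd.
have s0 : s != 0 by apply: contraTneq sy => ->; rewrite dotcC dotc0r ltxx.
have sBs := Bp _ s0; set b := dotc s (B *m s) in sBs.
split=> [|u u0].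
  rewrite /bfgs_update !raddfD /= raddfN /= !linearZ /= !trmx_mul !trmxK Bs.
  by rewrite !mulmxA.
pose a := dotc s (B *m u) / b; pose c := dotc y u.
have -> : dotc u (bfgs_update B s y *m u) =
    dotc (u - a *: s) (B *m (u - a *: s)) + c ^+ 2 / dotc s y.
  have -> : bfgs_update B s y *m u =
      B *m u - a *: (B *m s) + (c / dotc s y) *: y.
    rewrite /bfgs_update mulmxDl mulmxBl -!scalemxAl -!mulmxA mulmx_trE.
    rewrite mul_mx_scalar scalerA -/c (mulrC _ c); congr (_ - _ + _).
    rewrite mulmx_trE mul_mx_scalar -scalemxAr scalerA.
    by rewrite /a mulrC.
  rewrite mulmxBr -scalemxAr !dotcDr !dotcDl !dotcNr !dotcNl !dotcZr !dotcZl.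
  rewrite -/b (dotc_sym u s Bs) (dotcC u y) -/c /a.
  by field; rewrite !gt_eqF.
have [/eqP|us] := eqVneq (u - a *: s) 0; last first.
  by rewrite ltr_pwDl ?Bp // divr_ge0 ?sqr_ge0 // ltW.
rewrite subr_eq0 => /eqP us; rewrite us subrr mulmx0 dotc0r add0r.
rewrite divr_gt0 // exprn_even_gt0 //= /c us dotcZr (dotcC y) mulf_eq0 negb_or.
rewrite (gt_eqF sy) andbT.
by apply: contra_neq u0 => a0; rewrite us a0 scale0r.
Qed.

(** The update is B (1 + U V) with a two-column U, so Sylvester's identity leaves the 2 by 2 matrix
    1 + V U. Its first row is (0, 1) and its lower left entry is - (s, y) / (s, B s). *)
Lemma bfgs_update_det B s y : pdmx B -> 0 < dotc s y ->
  \det (bfgs_update B s y) = \det B * (dotc s y / dotc s (B *m s)).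
Proof.
move=> Bpd sy; have [Bs Bp] := Bpd; have Bu := pdmx_unit Bpd.
have s0 : s != 0 by apply: contraTneq sy => ->; rewrite dotcC dotc0r ltxx.
have sBs := Bp _ s0; set b := dotc s (B *m s) in sBs *; set r := dotc s y in sy *.
pose U := row_mx (- b^-1 *: s) (r^-1 *: (invmx B *m y)).
pose V := col_mx (B *m s)^T y^T.
have -> : bfgs_update B s y = B *m (1%:M + U *m V).
  rewrite mul_row_col mulmxDr mulmx1 /bfgs_update -/b -/r -addrA; congr (_ + _).
  rewrite mulmxDr -!scalemxAl -!scalemxAr scaleNr; congr (- _ + _).
    by rewrite trmx_mul Bs !mulmxA.
  by rewrite !mulmxA mulmxV // mul1mx.
rewrite det_mulmx det_addmx_mulC mul_col_row -!scalemxAr !mulmx_trE.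
have -> : dotc (B *m s) (invmx B *m y) = r.
  by rewrite dotc_mulmx invmx_sym // mulKmx.
rewrite (dotcC (B *m s) s) -/b (dotcC y s) -/r.
rewrite scalar_mx_block add_block_mx !add0r !scale_scalar_mx -!raddfD /=.
rewrite mulNr !mulVf ?gt_eqF // subrr raddf0 det_block0 -raddfN det_scalar1.
by rewrite mulNr opprK [b^-1 * r]mulrC.
Qed.

Lemma bfgs_update_tr W B s y : pdmx B ->
  \tr (W *m bfgs_update B s y) = \tr (W *m B)
    - dotc (B *m s) (W *m (B *m s)) / dotc s (B *m s)
    + dotc y (W *m y) / dotc s y.
Proof.
move=> [Bs _]; rewrite /bfgs_update mulmxDr mulmxBr !raddfD /= raddfN /=.
have trE u : \tr (W *m (u *m u^T)) = dotc u (W *m u).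
  by rewrite mulmxA mxtrace_mulC mulmx_trE mxtrace_scalar.
have -> : B *m s *m s^T *m B = (B *m s) *m (B *m s)^T.
  by rewrite trmx_mul Bs !mulmxA.
by rewrite -!scalemxAr !mxtraceZ !trE; congr (_ - _ + _); exact: mulrC.
Qed.

(** Cyclicity of the trace and multiplicativity of the determinant move the symmetric scaling of
    [Bbar] to one side, so that no square root enters the iteration. *)
Lemma Psi_congr (c : R) B S :
  Psi (c *: (S *m B *m S)) = Psi ((c *: (S *m S)) *m B).
Proof.
rewrite /Psi -!scalemxAl !linearZ /= !detZ mxtrace_mulC mulmxA.
by rewrite !det_mulmx mulrAC.
Qed.

(** [W *m B] may fail to be symmetric, but with S^2 = W it has the potential of the positive
    definite [S *m B *m S]. *)
Lemma Psi_mulmx_ge0 W B : pdmx W -> pdmx B -> 0 <= Psi (W *m B).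
Proof.
move=> /pdmx_sqrt_ex[S Spd SE] Bpd; have := Psi_congr 1 B S; rewrite !scale1r SE.
by move=> <-; apply/Psi_ge0/pdmx_congr; rewrite ?pdmx_unit //; case: Spd.
Qed.

(* The trace drops by [a := eta * (g, W g) / - (g, s)] and the log-determinant by
   [- ln (a * kappa)], and [ln a <= a - 1]. *)
Lemma Psi_bfgs_update W B g s y (eta : R) :
  pdmx W -> pdmx B -> g != 0 -> 0 < eta -> s = eta *: - (invmx B *m g) ->
  0 < dotc s y -> dotc y (W *m y) <= dotc s y ->
  Psi (W *m bfgs_update B s y) <=
  Psi (W *m B) + ln (dotc g s ^+ 2 / (dotc g (W *m g) * dotc s y)).
Proof.
move=> Wpd Bpd g0 eta0 sE sy yWy; have Bu := pdmx_unit Bpd.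
have W0 := pdmx_det_gt0 Wpd; have B0 := pdmx_det_gt0 Bpd.
have gWg : 0 < dotc g (W *m g) by case: Wpd => _; exact.
have Bs : B *m s = - eta *: g.
  by rewrite sE -scalemxAr mulmxN mulKVmx // scalerN scaleNr.
have sBs : dotc s (B *m s) = eta * - dotc g s.
  by rewrite Bs dotcZr dotcC mulNr mulrN.
have gs : 0 < - dotc g s.
  rewrite sE dotcZr dotcNr mulrN opprK mulr_gt0 //.
  by case: (pdmx_inv Bpd) => _; exact.
rewrite /Psi bfgs_update_tr // !det_mulmx bfgs_update_det // sBs Bs.
rewrite -scalemxAr dotcZl dotcZr.
set q := dotc g (W *m g) in gWg *; set p := - dotc g s in gs *.
have -> : dotc g s ^+ 2 = p ^+ 2 by rewrite sqrrN.
set r := dotc s y in sy yWy *.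
have a0 : 0 < eta * q / p by rewrite divr_gt0 ?mulr_gt0.
have k0 : 0 < p ^+ 2 / (q * r) by rewrite divr_gt0 ?mulr_gt0 ?exprn_gt0.
(* The determinant ratio of the update is 1 / (a kappa), which splits its logarithm. *)
have rE : r / (eta * p) = (eta * q / p)^-1 * (p ^+ 2 / (q * r))^-1.
  by field; rewrite !gt_eqF.
have lnE : ln (r / (eta * p)) = - ln (eta * q / p) - ln (p ^+ 2 / (q * r)).
  rewrite rE [LHS]lnM ?posrE ?invr_gt0 //.
  by rewrite [X in X + _]lnV ?posrE // [X in _ + X]lnV.
rewrite [\det W * _]mulrA [ln (_ * (r / _))]lnM ?posrE ?divr_gt0 ?mulr_gt0 // lnE.
have : ln (1 + (eta * q / p - 1)) <= eta * q / p - 1.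
  by rewrite le_ln1Dx // ltrBrDl subrr.
rewrite addrC subrK.
have : dotc y (W *m y) / r <= 1 by rewrite ler_pdivrMr // mul1r.
have -> : - eta * (- eta * q) / (eta * p) = eta * q / p.
  by field; rewrite !gt_eqF.
lra.
Qed.

End BFGS.

(** * Calculus along segments *)

Section Lines.
Context {R : realType}.

Lemma is_derive_line (V W : normedModType R) (f : V -> W) (a u : V) (t : R) df :
  is_derive (a + t *: u) u f df -> is_derive t 1 (fun r => f (a + r *: u)) df.
Proof.
move=> [fd fE].
have E : (fun h : R => h^-1 *:
    (((fun r => f (a + r *: u)) \o shift t) (h *: 1) - f (a + t *: u))) =
  (fun h => h^-1 *: ((f \o shift (a + t *: u)) (h *: u) - f (a + t *: u))).
  apply/funext => h /=; congr (_ *: (f _ - _)).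
  by rewrite scalerDl [h *: 1]mulr1 addrCA.
by apply: DeriveDef; rewrite /derivable /derive E.
Qed.

(** Takes the place of integration below: an increment is bounded by adding a comparison term and
    showing that the sum is nondecreasing. *)
Lemma le_is_derive (F dF : R -> R) (a b : R) : a <= b ->
  (forall x, a <= x <= b -> is_derive x 1 F (dF x)) ->
  (forall x, a <= x <= b -> 0 <= dF x) -> F a <= F b.
Proof.
move=> ab Fd dF0; have [||c] := @MVT_segment R F dF a b ab.
- by move=> x; rewrite in_itv /= => /andP[ax xb]; apply: Fd; rewrite !ltW.
- apply: derivable_within_continuous => x; rewrite in_itv /= => xab.
  by have [] := Fd _ xab.
rewrite in_itv /= => /dF0 c0 E.
by rewrite -subr_ge0 E mulr_ge0 // subr_ge0.
Qed.

Lemma is_derive_add_linear (F : R -> R) (c q df : R) :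
  is_derive q 1 F df -> is_derive q 1 (fun r => F r + c * r) (df + c).
Proof.
move=> Fd; have -> : (fun r => F r + c * r) = F + c *: id by [].
have -> : df + c = df + c *: 1 by rewrite [_%:A]mulr1.
by apply: is_deriveD; apply: is_deriveZ.
Qed.

Context {d : nat}.
Implicit Types (f : 'cV[R]_d -> R) (x u w a : 'cV[R]_d).

Lemma col_sum_delta u : u = \sum_i u i 0 *: (delta_mx i 0 : 'cV[R]_d).
Proof.
rewrite {1}[u]matrix_sum_delta; apply: eq_bigr => i _.
by rewrite big_ord_recl big_ord0 addr0.
Qed.

Lemma derive_gradient f x u : differentiable f x ->
  'D_u f x = dotc (gradient f x) u.
Proof.
move=> fd; rewrite deriveE // {1}[u]col_sum_delta linear_sum /dotc mxE.
by apply: eq_bigr => i _; rewrite linearZ !mxE deriveE // mulrC.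
Qed.

Lemma derive_hessian f x u : differentiable (gradient f) x ->
  'D_u (gradient f) x = hessian f x *m u.
Proof.
move=> fd; rewrite deriveE // {1}[u]col_sum_delta linear_sum.
apply/matrixP => i j; rewrite ord1 summxE mxE.
by apply: eq_bigr => k _; rewrite linearZ /= !mxE deriveE // mulrC.
Qed.

Lemma is_derive_f_line f a u (t : R) : twice_differentiable f ->
  is_derive t 1 (fun r => f (a + r *: u)) (dotc (gradient f (a + t *: u)) u).
Proof.
move=> [fd _]; apply: is_derive_line; apply: DeriveDef.
  exact: diff_derivable.
exact: derive_gradient.
Qed.

Lemma is_derive_gradient_line f a u w (t : R) : twice_differentiable f ->
  is_derive t 1 (fun r => dotc w (gradient f (a + r *: u)))
    (dotc w (hessian f (a + t *: u) *m u)).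
Proof.
move=> [_ gd].
have [gD gE] : is_derive t 1 (fun r => gradient f (a + r *: u))
    (hessian f (a + t *: u) *m u).
  apply: is_derive_line; apply: DeriveDef; first exact: diff_derivable.
  exact: derive_hessian.
have -> : (fun r => dotc w (gradient f (a + r *: u))) =
    \sum_i w i 0 *: (fun r => gradient f (a + r *: u) i 0).
  apply/funext => r; rewrite fct_sumE /dotc mxE.
  by apply: eq_bigr => i _; rewrite mxE.
have -> : dotc w (hessian f (a + t *: u) *m u) =
    \sum_i w i 0 *: (hessian f (a + t *: u) *m u) i 0.
  by rewrite /dotc mxE; apply: eq_bigr => i _; rewrite mxE.
apply: is_derive_sum => i; apply: is_deriveZ; apply: DeriveDef.
  exact: (derivable_mxP _ _ _).1.
by rewrite -gE derive_mx // mxE.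
Qed.

Lemma gradient_minimizer f xs : twice_differentiable f -> minimizer f xs ->
  gradient f xs = 0.
Proof.
move=> fd fmin; apply/matrixP => i j; rewrite ord1 [RHS]mxE.
have Fd := is_derive_f_line xs (delta_mx i 0) _ fd.
(* On each coordinate line, 0 is an interior minimum between -1 and 1. *)
have [|r _|||_] := @derive1_at_min R (fun r => f (xs + r *: delta_mx i 0)) (-1) 1 0.
- by rewrite (le_trans (lerN10 R)).
- by have [] := Fd r.
- by rewrite in_itv /= ltrN10 ltr01.
- by move=> r _; rewrite scale0r addr0.
rewrite (@derive_val _ _ _ _ _ _ _ (Fd 0)) scale0r addr0 => <-.
by rewrite -derive_gradient ?mxE //; exact: fd.1.
Qed.

End Lines.

(** * Gradient inequalities from Hessian bounds along a segment *)

Section Curvature.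
Context {R : realType} {d : nat} (f : 'cV[R]_d -> R).
Hypothesis f_diff2 : twice_differentiable f.
Hypothesis f_cvx : strictly_convex f.
Implicit Types (u v w a s : 'cV[R]_d).

Lemma dotc_subl_sqr (A : 'M[R]_d) u v : A^T = A ->
  dotc (u - v) (A *m (u - v)) =
  dotc u (A *m u) - 2 * dotc u (A *m v) + dotc v (A *m v).
Proof.
move=> As; rewrite mulmxBr !(dotcDr, dotcDl, dotcNr, dotcNl) (dotc_sym v u As).
by ring.
Qed.

(** The slope along the segment is nondecreasing, so the increment is at most the final slope. *)
Lemma convex_gradient_ineq a u :
  f (a + u) - f a <= dotc (gradient f (a + u)) u.
Proof.
pose G r := dotc u (gradient f (a + r *: u)).
have G_mono r : 0 <= r <= 1 -> G r <= G 1.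
  move=> /andP[r0 r1]; apply: (le_is_derive r1) => q _.
    exact: is_derive_gradient_line.
  exact: pdmx_ge0.
have := @le_is_derive R (fun r => - f (a + r *: u) + G 1 * r)
  (fun r => - G r + G 1) 0 1 ler01.
rewrite /G scale0r addr0 scale1r mulr0 mulr1 addr0 (dotcC u) => H.
have /H {}H : forall q : R, 0 <= q <= 1 -> is_derive q 1
    (fun r => - f (a + r *: u) + dotc (gradient f (a + u)) u * r)
    (- dotc u (gradient f (a + q *: u)) + dotc (gradient f (a + u)) u).
  move=> q _; apply: is_derive_add_linear; rewrite (dotcC u).
  exact/is_deriveN/is_derive_f_line.
have {}H : - f a <= - f (a + u) + dotc (gradient f (a + u)) u.
  apply: H => q /G_mono.
  rewrite /G scale1r (dotcC (gradient f (a + u))); lra.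
lra.
Qed.

(* Integrate 0 <= (s - w, H (s - w)) <= (s - 2 w, H s) + (w, P w), with H the
   Hessian along the segment. *)
Lemma gradient_cocoercive (P : 'M[R]_d) a s w :
  let y := gradient f (a + s) - gradient f a in
  (forall r v, 0 <= r <= 1 ->
    dotc v (hessian f (a + r *: s) *m v) <= dotc v (P *m v)) ->
  P *m w = y -> dotc y w <= dotc s y.
Proof.
move=> y HP wE; pose F r := dotc (s - 2 *: w) (gradient f (a + r *: s)).
have := @le_is_derive R (fun r => F r + dotc w y * r)
  (fun q => dotc (s - 2 *: w) (hessian f (a + q *: s) *m s) + dotc w y) 0 1 ler01.
rewrite /F scale0r addr0 scale1r mulr0 mulr1 addr0 => H.
have {H} : dotc (s - 2 *: w) (gradient f a) <=
    dotc (s - 2 *: w) (gradient f (a + s)) + dotc w y.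
  apply: H => q q01; first exact/is_derive_add_linear/is_derive_gradient_line.
  have [Hs _] := f_cvx (a + q *: s).
  have := pdmx_ge0 (s - w) (f_cvx (a + q *: s)); have := HP q w q01.
  rewrite wE dotc_subl_sqr // dotcDl dotcNl dotcZl.
  rewrite (dotc_sym w s Hs); lra.
have : dotc (s - 2 *: w) y =
    dotc (s - 2 *: w) (gradient f (a + s)) - dotc (s - 2 *: w) (gradient f a).
  by rewrite dotcDr dotcNr.
rewrite dotcDl dotcNl dotcZl (dotcC y).
lra.
Qed.

(* From 2 (u, g) - (u, Q u) <= (g, Q^-1 g). *)
Lemma gradient_domination (Q : 'M[R]_d) a u : gradient f a = 0 -> pdmx Q ->
  (forall r v, 0 <= r <= 1 ->
    dotc v (Q *m v) <= dotc v (hessian f (a + r *: u) *m v)) ->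
  f (a + u) - f a <=
  dotc (gradient f (a + u)) (invmx Q *m gradient f (a + u)).
Proof.
move=> ga Qpd QH; set g := gradient f (a + u).
apply: le_trans (convex_gradient_ineq a u) _; rewrite -/g.
have [Qs _] := Qpd; have Qu := pdmx_unit Qpd.
pose F r := dotc u (gradient f (a + r *: u)).
have := @le_is_derive R (fun r => F r + - dotc u (Q *m u) * r)
  (fun q => dotc u (hessian f (a + q *: u) *m u) + - dotc u (Q *m u)) 0 1 ler01.
rewrite /F scale0r addr0 scale1r mulr0 mulr1 addr0 -/g ga dotc0r => H.
(* The gradient vanishes at [a], so the Hessian bound gives (u, Q u) <= (u, g), that is, (u, g) <= 2
   (u, g) - (u, Q u). *)
have {H} : 0 <= dotc u g + - dotc u (Q *m u).
  apply: H => q q01; first exact/is_derive_add_linear/is_derive_gradient_line.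
  by rewrite subr_ge0 QH.
have := pdmx_ge0 (u - invmx Q *m g) Qpd.
rewrite dotc_subl_sqr // mulKVmx // (dotcC (invmx Q *m g)) (dotcC g u).
lra.
Qed.

End Curvature.

(** * Self-concordance *)

Section Omega.
Context {R : realType}.
Implicit Types x y z : R.

Lemma lt_ln1Dx z : 0 < z -> ln (1 + z) < z.
Proof.
move=> z0; rewrite -ltr_expR lnK ?posrE ?addr_gt0 //.
by apply: expR_gt1Dx; rewrite gt_eqF.
Qed.

(** The logarithm grows by ln (1 + z) < z with z = (y - x) / (1 + x), and z <= y - x. *)
Lemma ltr_omega x y : 0 <= x -> x < y -> omega x < omega y.
Proof.
move=> x0 xy; have x1 : 0 < 1 + x by rewrite ltr_wpDr.
have y1 : 0 < 1 + y by rewrite (lt_trans x1) // ltrD2l.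
have z0 : 0 < (y - x) / (1 + x) by rewrite divr_gt0 // subr_gt0.
have : ln (1 + y) < ln (1 + x) + (y - x) / (1 + x).
  have -> : 1 + y = (1 + x) * (1 + (y - x) / (1 + x)) by field; rewrite gt_eqF.
  by rewrite lnM ?posrE // ?addr_gt0 // ltrD2l lt_ln1Dx.
have : (y - x) / (1 + x) <= y - x.
  by rewrite ler_pdivrMr // ler_peMr ?subr_ge0 ?(ltW xy) // lerDl.
rewrite /omega; lra.
Qed.

Lemma ger0_is_derive_omega (m t : R) : 0 <= m -> 0 <= t ->
  is_derive t 1 (fun r : R => omega (m * r)) (m - m / (1 + m * t)).
Proof.
move=> m0 t0; have mt : 0 < 1 + m * t by rewrite ltr_wpDr // mulr_ge0.
have mD : is_derive t 1 (fun r : R => 0 + m * r) (0 + m).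
  exact: (is_derive_add_linear (F := cst 0) m (is_derive_cst _ _ _)).
have D1 : is_derive t 1 (fun r : R => 1 + m * r) (0 + m).
  exact: (is_derive_add_linear (F := cst 1) m (is_derive_cst _ _ _)).
have lnD : is_derive t 1 (fun r : R => ln (1 + m * r)) ((1 + m * t)^-1 * (0 + m)).
  exact: (@is_derive1_comp _ (@ln R) (fun r => 1 + m * r) t _ _
    (is_derive1_ln mt) D1).
have -> : (fun r : R => omega (m * r)) =
    (fun r : R => 0 + m * r) - (fun r => ln (1 + m * r)).
  by apply/funext => r; rewrite /omega !fctE add0r.
have -> : m - m / (1 + m * t) = (0 + m) - (1 + m * t)^-1 * (0 + m).
  by rewrite !add0r [_^-1 * _]mulrC.
exact: is_deriveB.
Qed.

Lemma omega0 : omega 0 = 0 :> R.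
Proof. by rewrite /omega addr0 ln1 subrr. Qed.

(** Intermediate values on [0, b] with b = 2 y + 1: here ln (1 + b) = ln 2 + ln (1 + y) <= 1 + y,
    hence omega b >= y. *)
Lemma omega_surj : set_surj `[0, +oo[%classic `[0, +oo[%classic (@omega R).
Proof.
move=> y; rewrite /= in_itv /= andbT => y0; pose b := 2 * y + 1.
have b0 : 0 <= b by rewrite /b; lra.
have yb : y <= omega b.
  have e : 1 + b = 2 * (1 + y) by rewrite /b; ring.
  have : ln (1 + b) <= y + 1.
    rewrite e lnM ?posrE ?ltr_wpDr //.
    have := le_ln1Dx (x := y); have := le_ln1Dx (x := 1 : R); lra.
  by rewrite /omega /b; lra.
have [||c cb <-] := @IVT R (@omega R) 0 b y b0.
- apply: derivable_within_continuous => x; rewrite in_itv /= => /andP[x0 _].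
  have [+ _] := ger0_is_derive_omega ler01 x0.
  by under eq_fun do rewrite mul1r.
- rewrite omega0 ge_min y0 le_max yb orbT //.
by exists c => //; move: cb; rewrite /= !in_itv /= andbT => /andP[].
Qed.

Lemma omega_inv_ge0 y : 0 <= y -> 0 <= omega_inv y.
Proof.
move=> y0.
have /(_ (omega_inv y)) := surjpinv_image_sub (dflt := fun=> 0) omega_surj.
rewrite /= in_itv /= andbT; apply; exists y => //.
by rewrite /= in_itv /= y0.
Qed.

Lemma omega_invK y : 0 <= y -> omega (omega_inv y) = y.
Proof.
by move=> y0; apply: (surjpK _ omega_surj); rewrite inE /= in_itv /= y0.
Qed.

Lemma omega_le_inv x y : 0 <= y -> omega x <= y -> x <= omega_inv y.
Proof.
move=> y0; rewrite -{1}(omega_invK y0); apply: contraTT.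
by rewrite -!ltNge; apply: ltr_omega; exact: omega_inv_ge0.
Qed.

End Omega.

(** * Hessian comparison and distance to the minimizer *)

Section SelfConcordance.
Context {R : realType} {d : nat} (f : 'cV[R]_d -> R) (M : R).
Hypothesis f_diff2 : twice_differentiable f.
Hypothesis f_cvx : strictly_convex f.
Hypothesis M_gt0 : 0 < M.
Hypothesis f_ssc : strongly_self_concordant f M.
Implicit Types (u v x y z xs : 'cV[R]_d).

Lemma local_norm_ge0 z u : 0 <= local_norm f z u.
Proof. exact: sqrtr_ge0. Qed.

Lemma sqr_local_norm z u : local_norm f z u ^+ 2 = dotc u (hessian f z *m u).
Proof. by rewrite sqr_sqrtr // pdmx_ge0. Qed.

Lemma local_normN z u : local_norm f z (- u) = local_norm f z u.
Proof. by rewrite /local_norm mulmxN dotcNr dotcNl opprK. Qed.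

Lemma local_normZ z (r : R) u : 0 <= r ->
  local_norm f z (r *: u) = r * local_norm f z u.
Proof.
move=> r0; rewrite /local_norm -scalemxAr dotcZr dotcZl mulrA -expr2.
by rewrite sqrtrM ?sqr_ge0 // sqrtr_sqr ger0_norm.
Qed.

(** The squared norm of the convex combination is the combination of the squares minus r (1 - r)
    times the squared norm of u - v. This keeps segments between iterates inside a ball around the
    minimizer. *)
Lemma local_norm_convex z u v (r K : R) : 0 <= r <= 1 ->
  local_norm f z u <= K -> local_norm f z v <= K ->
  local_norm f z (u + r *: (v - u)) <= K.
Proof.
move=> /andP[r0 r1] uK vK; have K0 := le_trans (local_norm_ge0 z u) uK.
have sqr_le w : local_norm f z w <= K -> dotc w (hessian f z *m w) <= K ^+ 2.
  by rewrite -sqr_local_norm => wK; rewrite lerXn2r ?nnegrE ?local_norm_ge0.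
rewrite -(@ler_pXn2r _ 2) ?nnegrE ?local_norm_ge0 // sqr_local_norm.
have [Hs _] := f_cvx z.
have := pdmx_ge0 (u - v) (f_cvx z); rewrite dotc_subl_sqr //.
have -> : dotc (u + r *: (v - u)) (hessian f z *m (u + r *: (v - u))) =
   (1 - r) * dotc u (hessian f z *m u) + r * dotc v (hessian f z *m v)
   - r * (1 - r) * (dotc u (hessian f z *m u)
      - 2 * dotc u (hessian f z *m v) + dotc v (hessian f z *m v)).
  rewrite !(mulmxDr, =^~ scalemxAr, mulmxN, dotcDr, dotcDl, dotcZr, dotcZl,
    dotcNr, dotcNl) (dotc_sym v u Hs).
  by ring.
have := sqr_le _ uK; have := sqr_le _ vK.
move: (dotc u (_ *m u)) (dotc v (_ *m v)) (dotc u (_ *m v)) (K ^+ 2).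
move=> a b c k bk ak abc.
have : 0 <= (1 - r) * (k - a) by rewrite mulr_ge0 // subr_ge0.
have : 0 <= r * (k - b) by rewrite mulr_ge0 // subr_ge0.
have : 0 <= r * (1 - r) * (a - 2 * c + b) by rewrite !mulr_ge0 // subr_ge0.
lra.
Qed.

(** Used with [z] the minimizer, and with either [x] or [y] equal to it, to bound the Hessian from
    both sides. *)
Lemma ssc_hessian_le x y z v (K : R) : M * local_norm f z (x - y) <= K ->
  dotc v (hessian f x *m v) <= (1 + K) * dotc v (hessian f y *m v).
Proof.
move=> HK; have [_ /(_ v)] := f_ssc x y z.
rewrite !mulmxBl -scalemxAl !(dotcDr, dotcNr, dotcZr) subr_ge0 lerBlDr => H.
apply: le_trans H _; rewrite mulrDl mul1r addrC lerD2l.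
exact: ler_wpM2r (pdmx_ge0 v (f_cvx y)) _ _ HK.
Qed.

(* Along the segment from xs, the second derivative of f is at least
   r^2 / (1 + M t r) >= r^2 / (1 + M t r / 2)^2, and the latter is the second
   derivative of 4 / M^2 * omega (M r t / 2). *)
Lemma omega_subopt x xs : minimizer f xs ->
  omega (M * local_norm f xs (x - xs) / 2) <= M ^+ 2 * subopt f xs x / 4.
Proof.
move=> fmin; set u := x - xs; set r := local_norm f xs u.
have g0 := gradient_minimizer f_diff2 fmin.
have r0 : 0 <= r := local_norm_ge0 _ _.
pose m := M * r / 2; have m0 : 0 <= m by rewrite /m divr_ge0 // mulr_ge0 // ltW.
pose c := M ^+ 2 / 4; have c0 : 0 <= c by rewrite divr_ge0 ?sqr_ge0.
have cr : c * r ^+ 2 = m ^+ 2 by rewrite /c /m; field.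
(* [k] is the derivative of c f(xs + t u) - omega(m t). It vanishes at 0, so monotonicity is applied
   twice: to [k], then to this function. *)
pose k t := c * dotc u (gradient f (xs + t *: u)) - (m - m / (1 + m * t)).
have k_ge0 t : 0 <= t -> 0 <= k t.
  move=> t0.
  have -> : 0 = k 0.
    by rewrite /k scale0r addr0 g0 dotc0r !mulr0 addr0 divr1 !subrr.
  pose dk q := c * dotc u (hessian f (xs + q *: u) *m u) - (m / (1 + m * q)) ^+ 2.
  apply: (@le_is_derive R k dk 0 t t0) => q /andP[q0 _].
    have mq : 0 < 1 + m * q by rewrite ltr_wpDr // mulr_ge0.
    have D1 : is_derive q 1 (fun r : R => 1 + m * r) (0 + m).
      exact: (is_derive_add_linear (F := cst 1) m (is_derive_cst _ _ _)).
    have DV := is_deriveV (f := fun r : R => 1 + m * r) (lt0r_neq0 mq) D1.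
    apply: (is_derive_eq (f' := c *: dotc u (hessian f (xs + q *: u) *m u) -
        (0 - m *: (- (1 + m * q) ^- 2 *: (0 + m))))).
      have -> : k = (c *: (fun r => dotc u (gradient f (xs + r *: u)))) -
          (cst m - m *: (fun r => (1 + m * r)^-1)) by [].
      have GD := is_derive_gradient_line xs u u q f_diff2.
      exact: is_deriveB.
    rewrite /dk sub0r opprK add0r expr_div_n; congr (_ + _).
    rewrite -![_ *: _]/(_ * _); move: (1 + m * q) mq => p p0.
    by field; rewrite gt_eqF.
  have mq : 0 < 1 + m * q by rewrite ltr_wpDr // mulr_ge0.
  rewrite /dk subr_ge0.
  (* Here M q r = 2 m q, and 1 + 2 m q <= (1 + m q)^2. *)
  have H : r ^+ 2 <= (1 + 2 * m * q) * dotc u (hessian f (xs + q *: u) *m u).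
    rewrite /r sqr_local_norm; apply: (ssc_hessian_le (z := xs)).
    rewrite opprD addrA subrr sub0r local_normN local_normZ // -/r le_eqVlt.
    by apply/predU1P; left; rewrite /m; field.
  rewrite expr_div_n ler_pdivrMr ?exprn_gt0 // -cr -[leRHS]mulrA ler_wpM2l //.
  apply: le_trans H _; rewrite mulrC ler_wpM2l ?pdmx_ge0 //.
  have := sqr_ge0 (m * q); lra.
have := @le_is_derive R (fun t => c * f (xs + t *: u) - omega (m * t)) k 0 1 ler01.
rewrite /= scale0r addr0 scale1r !mulr0 omega0 mulr1 subr0.
rewrite [xs + u]addrC subrK => H.
have {H} : c * f xs <= c * f x - omega m.
  apply: H => q /andP[q0 _]; last exact: k_ge0.
  apply: is_deriveB; last exact: ger0_is_derive_omega.
  by apply: is_deriveZ; rewrite dotcC; exact: is_derive_f_line.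
rewrite /subopt /c /m; lra.
Qed.

End SelfConcordance.

(** * Convergence rate *)

Section FinalArithmetic.
Context {R : realType}.

(* AM-GM on the factors, then e^x >= e^m (1 + x - m) at the mean m. *)
Lemma prod_onem_le (t : nat) (c S : R) (k : nat -> R) :
  (0 < t)%N -> 0 <= c -> (forall i, 0 < k i) -> (forall i, 0 <= 1 - c * k i) ->
  - S <= \sum_(i < t) ln (k i) ->
  0 <= 1 - c * expR (- S / t%:R) /\
  \prod_(i < t) (1 - c * k i) <= (1 - c * expR (- S / t%:R)) ^+ t.
Proof.
move=> t0 c0 k0 ck0 Sk; have tR : 0 < t%:R :> R by rewrite ltr0n.
set m := - S / t%:R.
have mt : m * t%:R = - S by rewrite /m divfK // gt_eqF.
have sumk : expR m * t%:R <= \sum_(i < t) k i.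
  apply: (@le_trans _ _ (\sum_(i < t) (expR m * (1 - m) + expR m * ln (k i)))).
    rewrite big_split /= sumr_const card_ord -mulr_sumr -mulr_natr.
    have := ler_wpM2l (expR_ge0 m) Sk; rewrite -mt; lra.
  apply: ler_sum => i _; rewrite -mulrDr.
  have kE : k i = expR m * expR (ln (k i) - m).
    by rewrite -expRD addrC subrK lnK ?posrE.
  rewrite [leRHS]kE ler_wpM2l ?expR_ge0 //.
  have := expR_ge1Dx (ln (k i) - m); lra.
have mean_le : (\sum_(i < t) (1 - c * k i)) / t%:R <= 1 - c * expR m.
  rewrite ler_pdivrMr // sumrB sumr_const card_ord -mulr_sumr.
  have := ler_wpM2l c0 sumk; lra.
have mean_ge0 : 0 <= (\sum_(i < t) (1 - c * k i)) / t%:R.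
  by rewrite divr_ge0 ?sumr_ge0.
(* Nonnegativity of the base is recorded for later comparisons of powers. *)
split; first exact: le_trans mean_le.
have [+ _] := @leif_AGM R 'I_t predT (fun i => 1 - c * k i) (fun i _ => ck0 i).
rewrite card_ord => /le_trans; apply.
by rewrite lerXn2r ?nnegrE // (le_trans mean_ge0).
Qed.

(** From e^x >= 1 + x at x = -1/6: the sixth power of 5/6 still exceeds 1/3, while the fifth power
    of 4/5 does not. *)
Lemma expRN1_ge : 1 / 3 <= expR (- 1) :> R.
Proof.
have -> : expR (- 1) = expR (- 6^-1) ^+ 6 :> R.
  by rewrite -expRM_natl; congr expR; field.
apply: (@le_trans _ _ ((1 - 6^-1) ^+ 6)); first lra.
by rewrite lerXn2r ?nnegrE ?expR_ge0 ?expR_ge1Dx //; lra.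
Qed.

End FinalArithmetic.

(** * One BFGS iteration *)

Section Step.
Context {R : realType} {d : nat} (f : 'cV[R]_d -> R) (M : R) (xs x0 : 'cV[R]_d).
Hypothesis f_diff2 : twice_differentiable f.
Hypothesis f_cvx : strictly_convex f.
Hypothesis M_gt0 : 0 < M.
Hypothesis f_ssc : strongly_self_concordant f M.
Hypothesis xs_min : minimizer f xs.
Implicit Types (x s u v g : 'cV[R]_d) (B : 'M[R]_d).

Let D := Dval f M xs x0.
Let K := 1 + D.
Let H := hessian f xs.
Let W := K^-1 *: invmx H.

Lemma Dval_ge0 : 0 <= D.
Proof.
rewrite mulr_ge0 // omega_inv_ge0 // divr_ge0 // mulr_ge0 ?sqr_ge0 //.
by rewrite subr_ge0.
Qed.

Let K_gt0 : 0 < K.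
Proof. by rewrite ltr_wpDr ?Dval_ge0. Qed.

(** [omega_subopt] controls [omega] of half the left side; inverting [omega] and doubling gives the
    factor 2 of [Dval]. *)
Lemma local_norm_le_Dval x : f x <= f x0 -> M * local_norm f xs (x - xs) <= D.
Proof.
move=> fx; pose Y := M ^+ 2 * subopt f xs x0 / 4.
have M2 : 0 <= M ^+ 2 / 4 by rewrite divr_ge0 ?sqr_ge0.
have Y0 : 0 <= Y by rewrite /Y mulrAC mulr_ge0 // subr_ge0.
have : M * local_norm f xs (x - xs) / 2 <= omega_inv Y.
  apply: omega_le_inv => //.
  apply: le_trans (omega_subopt f_diff2 f_cvx M_gt0 f_ssc x xs_min) _.
  by rewrite /Y !(mulrAC _ (subopt _ _ _)) ler_wpM2l // lerD2r.
by rewrite ler_pdivrMr // [leRHS]mulrC.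
Qed.

(** Otherwise [x] would be a minimizer too, with zero gradient. *)
Lemma subopt_gt0 x : gradient f x != 0 -> 0 < subopt f xs x.
Proof.
apply: contra_neqT; rewrite -leNgt /subopt subr_le0 => fx.
by apply: gradient_minimizer f_diff2 _ => z; exact: le_trans fx (xs_min z).
Qed.

Lemma weight_pd : pdmx W.
Proof.
by apply: pdmx_scale; [rewrite invr_gt0 | exact/pdmx_inv/f_cvx].
Qed.

(** Gradient domination with Q = H / K, whose inverse is K^2 W. *)
Lemma weighted_gradient_domination x : f x <= f x0 ->
  subopt f xs x <= K ^+ 2 * dotc (gradient f x) (W *m gradient f x).
Proof.
move=> fx; pose u := x - xs; have Hpd : pdmx H := f_cvx xs.
have Qpd : pdmx (K^-1 *: H) by apply: pdmx_scale; rewrite ?invr_gt0.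
have := gradient_domination f_diff2 f_cvx (gradient_minimizer f_diff2 xs_min) Qpd.
move=> /(_ u); rewrite [xs + u]addrC subrK => dom.
have -> : K ^+ 2 * dotc (gradient f x) (W *m gradient f x) =
    dotc (gradient f x) (invmx (K^-1 *: H) *m gradient f x).
  rewrite invmxZ ?unitfE ?invr_eq0 ?gt_eqF ?pdmx_unit // invrK /W.
  by rewrite -!scalemxAl !dotcZr mulrA expr2 mulfK // gt_eqF.
apply: dom => r v /andP[r0 r1]; rewrite -scalemxAl dotcZr mulrC ler_pdivrMr //.
rewrite mulrC; apply: (ssc_hessian_le f_cvx f_ssc (z := xs)).
rewrite opprD addrA subrr sub0r local_normN local_normZ //.
apply: le_trans (local_norm_le_Dval fx).
by rewrite ler_wpM2l ?(ltW M_gt0) // ler_piMl ?local_norm_ge0.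
Qed.

(** Cocoercivity with P = K H and w = W y; both endpoints, hence the segment, lie in the ball of
    radius D / M around [xs]. *)
Lemma weighted_cocoercive x s (y := gradient f (x + s) - gradient f x) :
  f x <= f x0 -> f (x + s) <= f x0 -> dotc y (W *m y) <= dotc s y.
Proof.
move=> fx fxs; have Hu : H \in unitmx := pdmx_unit (f_cvx xs).
apply: (gradient_cocoercive f_diff2 f_cvx (P := K *: H)) => [r v r01|].
  rewrite -scalemxAl dotcZr; apply: (ssc_hessian_le f_cvx f_ssc (z := xs)).
  have near z : f z <= f x0 -> local_norm f xs (z - xs) <= D / M.
    by move=> fz; rewrite ler_pdivlMr // mulrC local_norm_le_Dval.
  have -> : x + r *: s - xs = (x - xs) + r *: ((x + s - xs) - (x - xs)).
    by rewrite opprB addrA addrNK (addrC x s) addrK addrAC.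
  rewrite mulrC -ler_pdivlMr //.
  by apply: local_norm_convex => //; exact: near.
by rewrite /W -!scalemxAl -scalemxAr scalerA mulKVmx // mulfV ?scale1r ?gt_eqF.
Qed.

Lemma bfgs_step (alpha beta eta : R) x B :
  0 < alpha -> beta < 1 -> pdmx B -> gradient f x != 0 -> f x <= f x0 -> 0 < eta ->
  armijo_wolfe f alpha beta x (bfgs_dir f x B) eta ->
  let s := eta *: bfgs_dir f x B in
  let y := gradient f (x + s) - gradient f x in
  let B' := bfgs_update B s y in
  exists2 kappa : R,
    [/\ 0 < kappa, 0 <= 1 - alpha * (1 - beta) / K ^+ 2 * kappa &
        subopt f xs (x + s) <=
          (1 - alpha * (1 - beta) / K ^+ 2 * kappa) * subopt f xs x] &
    [/\ f (x + s) <= f x0, pdmx B' & Psi (W *m B') <= Psi (W *m B) + ln kappa].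
Proof.
move=> a0 b1 Bpd g0 fx eta0 [armijo wolfe] s y B'; set g := gradient f x in g0 *.
have q0 : 0 < dotc g (W *m g) by case: weight_pd => _; exact.
have gsE : dotc g s = eta * dotc g (bfgs_dir f x B) by rewrite dotcZr.
have gs : 0 < - dotc g s.
  rewrite gsE dotcNr mulrN opprK mulr_gt0 //.
  by case: (pdmx_inv Bpd) => _; exact.
have descent : f (x + s) <= f x - alpha * - dotc g s.
  by move: armijo; rewrite -/s -/g gsE mulrN opprK mulrA.
have curv : (1 - beta) * - dotc g s <= dotc s y.
  have := ler_wpM2l (ltW eta0) wolfe; rewrite -/s -/g.
  rewrite [dotc s y]dotcDr dotcNr (dotcC s g) gsE [dotc s _]dotcZl.
  rewrite (dotcC (bfgs_dir f x B)).
  lra.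
have sy : 0 < dotc s y by rewrite (lt_le_trans _ curv) // mulr_gt0 ?subr_gt0.
have fxs : f (x + s) <= f x0.
  apply: le_trans descent (le_trans _ fx).
  by rewrite lerBlDr lerDl mulr_ge0 ?ltW.
pose kappa := dotc g s ^+ 2 / (dotc g (W *m g) * dotc s y).
have k0 : 0 < kappa.
  by rewrite divr_gt0 ?(mulr_gt0 q0) // -sqrrN exprn_gt0.
have C0 := subopt_gt0 g0.
have rate : subopt f xs (x + s) <=
    (1 - alpha * (1 - beta) / K ^+ 2 * kappa) * subopt f xs x.
  have dom := weighted_gradient_domination fx; rewrite -/g in dom.
  have : alpha * (1 - beta) / K ^+ 2 * kappa * subopt f xs x <= alpha * - dotc g s.
    have c0 : 0 <= alpha * (1 - beta) / K ^+ 2 * kappa.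
      by rewrite mulr_ge0 ?(ltW k0) // divr_ge0 ?sqr_ge0 // mulr_ge0 ?subr_ge0 ?ltW.
    apply: le_trans (ler_wpM2l c0 dom) _.
    (* After cancelling K^2 and (g, W g), the Armijo decrease is left times a ratio that the Wolfe
       condition bounds by 1. *)
    have -> : alpha * (1 - beta) / K ^+ 2 * kappa *
        (K ^+ 2 * dotc g (W *m g)) =
        alpha * - dotc g s * ((1 - beta) * - dotc g s / dotc s y).
      rewrite /kappa; move: (dotc g (W *m g)) (dotc s y) q0 sy => q r q0 r0.
      by field; rewrite !gt_eqF.
    rewrite ler_piMr ?mulr_ge0 ?(ltW a0) ?(ltW gs) //.
    by rewrite ler_pdivrMr // mul1r.
  move: descent; rewrite /subopt; move: (f _) (f x) (- dotc g s) => p q r; lra.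
exists kappa; split=> //.
(* The factor is nonnegative because the next gap is nonnegative and the current one positive. *)
- have := le_trans _ rate; rewrite -(pmulr_lge0 _ C0); apply.
  by rewrite subr_ge0.
- exact: bfgs_update_pd.
- apply: (Psi_bfgs_update weight_pd Bpd g0 eta0) => //.
  exact: weighted_cocoercive.
Qed.

End Step.

(** * Linear rate along the whole run *)

Theorem theorem3p1 (R : realType) (d : nat) (f : 'cV[R]_d -> R) (M : R)
    (xs : 'cV[R]_d) (alpha beta : R)
    (x : nat -> 'cV[R]_d) (B : nat -> 'M[R]_d) (eta : nat -> R)
    (f_diff2 : twice_differentiable f)
    (f_cvx : strictly_convex f)
    (M_gt0 : 0 < M)
    (f_ssc : strongly_self_concordant f M)
    (xs_min : minimizer f xs)
    (alpha_gt0 : 0 < alpha) (alpha_lt_beta : alpha < beta) (beta_lt1 : beta < 1)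
    (alpha_lt_half : alpha < 1 / 2)
    (B0_pd : pdmx (B 0%N))
    (run : bfgs_run f x B eta)
    (step : forall t : nat,
        armijo_wolfe f alpha beta (x t) (bfgs_dir f (x t) (B t)) (eta t))
    (t : nat) (t_ge1 : (1 <= t)%N) :
  let D0 := Dval f M xs (x 0%N) in
  let Psi0 := Psi (Bbar f M xs (x 0%N) (B 0%N)) in
  (f (x t) - f xs) / (f (x 0%N) - f xs) <=
    (1 - alpha * (1 - beta) * expR (- Psi0 / t%:R) / (1 + D0) ^+ 2) ^+ t
  /\
  (Psi0 <= t%:R ->
    (f (x t) - f xs) / (f (x 0%N) - f xs) <=
      (1 - alpha * (1 - beta) / (3 * (1 + D0) ^+ 2)) ^+ t).
Proof.
move=> D0 Psi0.
pose W := (1 + D0)^-1 *: invmx (hessian f xs).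
have PsiE : Psi (W *m B 0%N) = Psi0.
  have [_ SE] := sqrtmxP (pdmx_inv (f_cvx xs)).
  by rewrite /Psi0 /Bbar Psi_congr /invsqrtmx SE.
pose s n := eta n *: bfgs_dir f (x n) (B n).
have xS n : x n.+1 = x n + s n by have [] := run n.
have BS n : B n.+1 = bfgs_update (B n) (s n)
    (gradient f (x n + s n) - gradient f (x n)).
  by have [_ _ _ ->] := run n; rewrite xS addrAC subrr add0r.
pose c := alpha * (1 - beta) / (1 + D0) ^+ 2.
pose step_spec n (k : R) := [/\ 0 < k, 0 <= 1 - c * k,
  subopt f xs (x n.+1) <= (1 - c * k) * subopt f xs (x n) &
  Psi (W *m B n.+1) <= Psi (W *m B n) + ln k].
(* The one-step estimate presupposes two invariants; these are propagated by induction before the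
   factors kappa are chosen as a sequence. *)
have step_ex n : f (x n) <= f (x 0%N) -> pdmx (B n) ->
    [/\ f (x n.+1) <= f (x 0%N), pdmx (B n.+1) & exists k, step_spec n k].
  move=> fn Bn; have [gn en _ _] := run n; rewrite /step_spec xS BS.
  have [k [k1 k2 k3] [k4 k5 k6]] := bfgs_step f_diff2 f_cvx M_gt0 f_ssc xs_min
    alpha_gt0 beta_lt1 Bn gn fn en (step n).
  by split=> //; exists k.
have inv n : f (x n) <= f (x 0%N) /\ pdmx (B n).
  by elim: n => [//|n [fn Bn]]; have [] := step_ex n fn Bn.
have /choice[k kP] n : exists k, step_spec n k.
  by have [fn Bn] := inv n; have [] := step_ex n fn Bn.
have C0 : 0 < subopt f xs (x 0%N).
  by apply: subopt_gt0 => //; have [] := run 0%N.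
have rate n : subopt f xs (x n) <=
    \prod_(i < n) (1 - c * k i) * subopt f xs (x 0%N).
  elim: n => [|n IH]; first by rewrite big_ord0 mul1r.
  rewrite big_ord_recr /= mulrAC mulrC; have [_ k2 k3 _] := kP n.
  exact: le_trans k3 (ler_wpM2l k2 IH).
have potential n : Psi (W *m B n) <= Psi0 + \sum_(i < n) ln (k i).
  elim: n => [|n IH]; first by rewrite big_ord0 addr0 PsiE.
  rewrite big_ord_recr /= addrA; have [_ _ _ k4] := kP n.
  by apply: le_trans k4 _; rewrite lerD2r.
have K0 : 0 < 1 + D0 by rewrite ltr_wpDr // Dval_ge0.
have c0 : 0 <= c.
  by rewrite /c divr_ge0 ?sqr_ge0 // mulr_ge0 ?subr_ge0 // ltW.
have [|||base prod_le] := prod_onem_le (S := Psi0) (c := c) (k := k) t_ge1 c0.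
- by move=> i; have [] := kP i.
- by move=> i; have [] := kP i.
- have Wpd : pdmx W by exact: weight_pd.
  have := Psi_mulmx_ge0 Wpd (inv t).2.
  by move=> /le_trans /(_ (potential t)); rewrite addrC -lerBlDr sub0r.
have cE e : alpha * (1 - beta) * e / (1 + D0) ^+ 2 = c * e by rewrite mulrAC.
have main : (f (x t) - f xs) / (f (x 0%N) - f xs) <=
    (1 - c * expR (- Psi0 / t%:R)) ^+ t.
  rewrite ler_pdivrMr //; apply: le_trans (rate t) _.
  by rewrite ler_wpM2r // ltW.
rewrite cE; split=> // Psi_t; apply: le_trans main _.
(* The exponent is at least -1 once [t] reaches [Psi0]. *)
have le13 : 1 / 3 <= expR (- Psi0 / t%:R).
  apply: le_trans expRN1_ge _; rewrite ler_expR mulNr lerN2 ler_pdivrMr ?ltr0n //.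
  by rewrite mul1r.
have -> : alpha * (1 - beta) / (3 * (1 + D0) ^+ 2) = c * (1 / 3).
  by rewrite /c; field; rewrite gt_eqF.
have le_base : 1 - c * expR (- Psi0 / t%:R) <= 1 - c * (1 / 3).
  by rewrite lerD2l lerN2 ler_wpM2l.
by rewrite lerXn2r ?nnegrE // (le_trans base).
Qed.
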